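(* Consider a line congruence $f(u,v)=(u,v,0)$, $\xi(u,v)=(\xi_1(u,v),\xi_2(u,v),1)$ on an open set $U\subset\mathbb{R}^2$, with $\xi_1,\xi_2$ smooth, such that $0$ is a regular value of the discriminant $\delta$. Then the ridge curve touches the discriminant curve only at singular points: if a point $p\in U$ with $\delta(p)=0$ belongs to the closure of the set of ridge points, then $p$ is a singular point of the discriminant curve, i.e. the unique principal direction at $p$ is tangent to the curve $\delta=0$.
   Context: Put $a=-(\xi_1)_u$, $b=-(\xi_1)_v$, $c=-(\xi_2)_u$, $d=-(\xi_2)_v$, so that $S=\begin{pmatrix}a&b\\ c&d\end{pmatrix}$ is the shape operator of the congruence ($\xi_u=-af_u-cf_v$, $\xi_v=-bf_u-df_v$). Eigenvectors of $S$ are called principal directions, and $\delta=(a-d)^2+4bc$ is the discriminant. When $0$ is a regular value of $\delta$, the set $\delta=0$ is a regular curve (the discriminant curve), at each point of which $S$ has a double eigenvalue with one-dimensional eigenspace. In the region $\delta>0$ the eigenvalues $\lambda_1>\lambda_2$ of $S$ are smooth functions; a point of this region is a ridge point if $d\lambda_i(X)=0$ for some $i\in\{1,2\}$ and some non-zero eigenvector $X$ of $S$ for $\lambda_i$ (equivalently, when $\lambda_i\ne0$, the focal surface $f+\lambda_i^{-1}\xi$ is singular there). *)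

(* Defs.v *)
From Stdlib Require Import Reals.
From Coquelicot Require Import Coquelicot.
Open Scope R_scope.

Definition d_u (f : R -> R -> R) (u v : R) : R := Derive (fun s => f s v) u.
Definition d_v (f : R -> R -> R) (u v : R) : R := Derive (fun t => f u t) v.

Definition differential (f : R -> R -> R) (p X : R * R) : R :=
  d_u f (fst p) (snd p) * fst X + d_v f (fst p) (snd p) * snd X.

(* [ex_diff_n f n u v]: all partial derivatives of f of order at most n exist
   and are continuous at (u,v). Since U is open, the values of f outside U are
   irrelevant. *)
Definition smooth_on (U : R * R -> Prop) (f : R -> R -> R) : Prop :=
  forall p, U p -> forall n, ex_diff_n f n (fst p) (snd p).

Definition closure (A : R * R -> Prop) (p : R * R) : Prop :=
  forall V : R * R -> Prop, locally p V -> exists q, V q /\ A q.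

(* The velocity at p of a C^1 path that stays in A. *)
Definition tangent_vector (A : R * R -> Prop) (p X : R * R) : Prop :=
  exists g1 g2 : R -> R,
    (g1 0, g2 0) = p /\
    (Derive g1 0, Derive g2 0) = X /\
    locally 0 (fun t : R =>
      A (g1 t, g2 t) /\
      ex_derive g1 t /\ ex_derive g2 t /\
      continuous (Derive g1) t /\ continuous (Derive g2) t).

(* The congruence f(u,v) = (u,v,0), xi(u,v) = (xi1(u,v),xi2(u,v),1) is given by
   its two non-constant components; as xi_u and xi_v are then horizontal,
   xi_u = - a f_u - c f_v and xi_v = - b f_u - d f_v determine the entries. *)
Definition S11 (xi1 xi2 : R -> R -> R) (u v : R) : R := - d_u xi1 u v.
Definition S12 (xi1 xi2 : R -> R -> R) (u v : R) : R := - d_v xi1 u v.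
Definition S21 (xi1 xi2 : R -> R -> R) (u v : R) : R := - d_u xi2 u v.
Definition S22 (xi1 xi2 : R -> R -> R) (u v : R) : R := - d_v xi2 u v.

Definition shape (xi1 xi2 : R -> R -> R) (p X : R * R) : R * R :=
  let (u, v) := p in
  (S11 xi1 xi2 u v * fst X + S12 xi1 xi2 u v * snd X,
   S21 xi1 xi2 u v * fst X + S22 xi1 xi2 u v * snd X).

Definition eigenvector (xi1 xi2 : R -> R -> R) (p : R * R) (l : R)
    (X : R * R) : Prop :=
  X <> (0, 0) /\ shape xi1 xi2 p X = (l * fst X, l * snd X).

Definition eigenvalue (xi1 xi2 : R -> R -> R) (p : R * R) (l : R) : Prop :=
  exists X, eigenvector xi1 xi2 p l X.

Definition principal_direction (xi1 xi2 : R -> R -> R) (p X : R * R) : Prop :=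
  exists l, eigenvector xi1 xi2 p l X.

Definition discriminant (xi1 xi2 : R -> R -> R) (u v : R) : R :=
  (S11 xi1 xi2 u v - S22 xi1 xi2 u v) ^ 2
  + 4 * S12 xi1 xi2 u v * S21 xi1 xi2 u v.

Definition discriminant_curve (U : R * R -> Prop) (xi1 xi2 : R -> R -> R)
    (p : R * R) : Prop :=
  U p /\ discriminant xi1 xi2 (fst p) (snd p) = 0.

Definition regular_value_0 (U : R * R -> Prop) (f : R -> R -> R) : Prop :=
  forall p, U p -> f (fst p) (snd p) = 0 ->
    exists X, differential f p X <> 0.

Definition hyperbolic_region (U : R * R -> Prop) (xi1 xi2 : R -> R -> R)
    (p : R * R) : Prop :=
  U p /\ 0 < discriminant xi1 xi2 (fst p) (snd p).

(* As S has at most two eigenvalues, this determines l1 and l2 on the region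
   where the discriminant is positive. *)
Definition ordered_eigenvalues (U : R * R -> Prop) (xi1 xi2 : R -> R -> R)
    (l1 l2 : R -> R -> R) : Prop :=
  forall p, hyperbolic_region U xi1 xi2 p ->
    eigenvalue xi1 xi2 p (l1 (fst p) (snd p)) /\
    eigenvalue xi1 xi2 p (l2 (fst p) (snd p)) /\
    l2 (fst p) (snd p) < l1 (fst p) (snd p).

Definition ridge_point (U : R * R -> Prop) (xi1 xi2 : R -> R -> R)
    (p : R * R) : Prop :=
  hyperbolic_region U xi1 xi2 p /\
  exists l1 l2 : R -> R -> R,
    ordered_eigenvalues U xi1 xi2 l1 l2 /\
    exists l : R -> R -> R, (l = l1 \/ l = l2) /\
    exists X : R * R,
      eigenvector xi1 xi2 p (l (fst p) (snd p)) X /\ differential l p X = 0.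

(* There is a principal direction at p, it is unique up to scaling, and it is
   tangent to the discriminant curve. *)
Definition singular_point (U : R * R -> Prop) (xi1 xi2 : R -> R -> R)
    (p : R * R) : Prop :=
  discriminant_curve U xi1 xi2 p /\
  exists X : R * R,
    principal_direction xi1 xi2 p X /\
    (forall Y, principal_direction xi1 xi2 p Y ->
       exists k : R, Y = (k * fst X, k * snd X)) /\
    tangent_vector (discriminant_curve U xi1 xi2) p X.

(* Main.v *)
(** With T and D the trace and discriminant of S, the eigenvalues on D > 0 are
    (T + s sqrt D) / 2 with s = 1 or -1, so an eigenvector X satisfies
    dl(X) = 0 iff s dD(X) + 2 sqrt D dT(X) = 0. Suitable multiples of X extend
    continuously in the point to D = 0, where this equation becomes dD(X) = 0 for
    the double eigenvector X. As 0 is a regular value of D, the implicit function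
    theorem turns X into the velocity of a path in the discriminant curve. *)

From Stdlib Require Import Reals Lra Ranalysis5 ClassicalEpsilon.
From Coquelicot Require Import Coquelicot.
Require Import Defs.
Open Scope R_scope.

(** A ridge point comes with an eigenvector of arbitrary length, so eigenvectors along a sequence of
    ridge points need not converge. With a, b, c, d the entries of S and r = sqrt D, the doubled
    adjugate columns (2b, d - a + s r) and (a - d + s r, 2c) replace them: they are continuous up to
    D = 0 and are multiples of every eigenvector for (T + s r) / 2. A column may vanish somewhere,
    which is harmless because the equation of a ridge point is linear in X. Only at the limit point
    must one column be non-zero, and there regularity enters a second time: D is a quadratic form in
    (a - d, b, c), so dD = 0 wherever S is scalar; hence b or c is non-zero at the limit. Since a
    tangent vector is the velocity of a path that is C^1 near 0, the implicit function has to be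
    differentiable on a neighbourhood and not only at the base point. *)

(** * Functions of class C^1 in two variables *)

Definition C1_at (f : R -> R -> R) (u v : R) : Prop :=
  ex_derive (fun s => f s v) u /\ ex_derive (fun t => f u t) v /\
  continuity_2d_pt (d_u f) u v /\ continuity_2d_pt (d_v f) u v.

(** [Derive] is total, so continuity of [d_u f] at one point does not make f differentiable nearby;
    this is why [C1_at] is assumed on a neighbourhood. *)
Lemma C1_at_differentiable f u v :
  locally_2d (C1_at f) u v -> differentiable_pt_lim f u v (d_u f u v) (d_v f u v).
Proof.
  intros H.
  apply filterdiff_differentiable_pt_lim.
  apply (is_derive_filterdiff f u v (d_u f) (d_v f u v)).
  - apply (locally_2d_locally (fun x y => is_derive (fun z => f z y) x (d_u f x y))).
    revert H; apply locally_2d_impl, locally_2d_forall; intros x y [H _].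
    now apply Derive_correct.
  - apply Derive_correct, (locally_2d_singleton _ _ _ H).
  - apply continuity_2d_pt_filterlim, (locally_2d_singleton _ _ _ H).
Qed.

Lemma C1_at_ext f g u v :
  (forall x y, f x y = g x y) -> C1_at f u v -> C1_at g u v.
Proof.
  intros E (H1 & H2 & H3 & H4); repeat split.
  - now apply (ex_derive_ext (fun s => f s v)).
  - now apply (ex_derive_ext (fun t => f u t)).
  - apply (continuity_2d_pt_ext (d_u f)); trivial.
    intros x y; apply Derive_ext; auto.
  - apply (continuity_2d_pt_ext (d_v f)); trivial.
    intros x y; apply Derive_ext; auto.
Qed.

Lemma C1_at_opp f u v :
  C1_at f u v -> C1_at (fun x y => - f x y) u v.
Proof.
  intros (H1 & H2 & H3 & H4); repeat split.
  - now apply (ex_derive_opp (fun s => f s v)).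
  - now apply (ex_derive_opp (fun t => f u t)).
  - apply (continuity_2d_pt_ext (fun x y => - d_u f x y)).
    { intros x y; symmetry; apply Derive_opp. }
    now apply continuity_2d_pt_opp.
  - apply (continuity_2d_pt_ext (fun x y => - d_v f x y)).
    { intros x y; symmetry; apply Derive_opp. }
    now apply continuity_2d_pt_opp.
Qed.

Lemma locally_2d_swap (P : R -> R -> Prop) u v :
  locally_2d P u v -> locally_2d (fun x y => P y x) v u.
Proof. intros [e H]; exists e; auto. Qed.

Lemma continuity_2d_pt_swap f u v :
  continuity_2d_pt f u v -> continuity_2d_pt (fun x y => f y x) v u.
Proof.
  intros H e.
  exact (locally_2d_swap _ _ _ (H e)).
Qed.

Lemma C1_at_swap f u v : C1_at f u v -> C1_at (fun x y => f y x) v u.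
Proof.
  intros (H1 & H2 & H3 & H4); repeat split; auto.
  - exact (continuity_2d_pt_swap _ _ _ H4).
  - exact (continuity_2d_pt_swap _ _ _ H3).
Qed.

(** * The implicit function theorem in the plane *)

(** Two zeros are joined by a vertical and a horizontal leg through (x, y'); the increments of F
    along the legs cancel, and the mean value theorem estimates each. The bound serves twice: x = x'
    gives uniqueness of the zero on a vertical line, and in general the implicit function is
    Lipschitz with constant M / m. *)
Lemma zero_set_lipschitz F I J m M :
  (forall x x' z, I x -> I x' -> Rmin x x' <= z <= Rmax x x' -> I z) ->
  (forall y y' z, J y -> J y' -> Rmin y y' <= z <= Rmax y y' -> J z) ->
  (forall x y, I x -> J y ->
     ex_derive (fun s => F s y) x /\ ex_derive (fun t => F x t) y /\
     Rabs (d_u F x y) <= M /\ m <= d_v F x y) ->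
  0 < m ->
  forall x y x' y', I x -> J y -> I x' -> J y' -> F x y = 0 -> F x' y' = 0 ->
  m * Rabs (y' - y) <= M * Rabs (x' - x).
Proof.
  intros HI HJ HF Hm x y x' y' Ix Jy Ix' Jy' E E'.
  destruct (MVT_gen (fun s => F s y') x x' (fun s => d_u F s y')) as (c & Hc & Ec).
  { intros z Hz; refine (Derive_correct _ _ (proj1 (HF _ _ _ _))); trivial.
    apply (HI x x'); trivial; lra. }
  { intros z Hz; apply continuity_pt_filterlim.
    refine (ex_derive_continuous (fun s => F s y') _ (proj1 (HF _ _ _ _))); trivial.
    apply (HI x x'); trivial; lra. }
  destruct (MVT_gen (fun t => F x t) y y' (fun t => d_v F x t)) as (e & He & Ee).
  { intros z Hz; refine (Derive_correct _ _ (proj1 (proj2 (HF _ _ _ _)))); trivial.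
    apply (HJ y y'); trivial; lra. }
  { intros z Hz; apply continuity_pt_filterlim.
    refine (ex_derive_continuous (fun t => F x t) _ (proj1 (proj2 (HF _ _ _ _)))); trivial.
    apply (HJ y y'); trivial; lra. }
  assert (Ic : I c) by (apply (HI x x'); trivial).
  assert (Je : J e) by (apply (HJ y y'); trivial).
  destruct (HF _ _ Ic Jy') as (_ & _ & B1 & _).
  destruct (HF _ _ Ix Je) as (_ & _ & _ & B2).
  assert (Eq : d_v F x e * (y' - y) = - (d_u F c y' * (x' - x))) by lra.
  apply (f_equal Rabs) in Eq; rewrite Rabs_Ropp, !Rabs_mult in Eq.
  rewrite (Rabs_right (d_v F x e)) in Eq by lra.
  apply Rle_trans with (d_v F x e * Rabs (y' - y)).
  - apply Rmult_le_compat_r; [apply Rabs_pos | exact B2].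
  - rewrite Eq; apply Rmult_le_compat_r; [apply Rabs_pos | exact B1].
Qed.

(** Total differentiability of F along the graph gives A h + B D = o(max(|h|, |D|)) for the
    increments h of x and D of [phi]. The Lipschitz bound turns the error into o(|h|), and dividing
    by B h gives the derivative. *)
Lemma implicit_derivative F phi x K :
  locally_2d (C1_at F) x (phi x) ->
  0 < d_v F x (phi x) ->
  F x (phi x) = 0 ->
  locally x (fun z => F z (phi z) = 0 /\ Rabs (phi z - phi x) <= K * Rabs (z - x)) ->
  is_derive phi x (- d_u F x (phi x) / d_v F x (phi x)).
Proof.
  intros HC Hv H0 [d Hd].
  set (A := d_u F x (phi x)); set (B := d_v F x (phi x)) in *.
  (* This C is at least 1 and at least K, so C |h| bounds both |h| and |D|, whatever the sign of
     K. *)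
  set (C := 1 + Rabs K).
  assert (HCpos : 1 <= C) by (unfold C; pose proof (Rabs_pos K); lra).
  apply is_derive_Reals; intros eps Heps.
  (* The factor C is lost in bounding max(|h|, |D|), B in the final division, and 2 makes the
     resulting inequality strict. *)
  assert (He' : 0 < eps * B / (2 * C)).
  { apply Rdiv_lt_0_compat; [now apply Rmult_lt_0_compat | lra]. }
  destruct (C1_at_differentiable _ _ _ HC (mkposreal _ He')) as [d1 Hd1].
  cbn [pos] in Hd1; fold A B in Hd1.
  assert (Hd2 : 0 < Rmin d (d1 / C)).
  { apply Rmin_pos; [apply cond_pos | apply Rdiv_lt_0_compat; [apply cond_pos | lra]]. }
  exists (mkposreal _ Hd2); cbn [pos]; intros h Hh0 Hh.
  assert (Hhd : Rabs h < d) by (eapply Rlt_le_trans; [exact Hh | apply Rmin_l]).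
  assert (Hhd1 : C * Rabs h < d1).
  { assert (Rabs h < d1 / C) by (eapply Rlt_le_trans; [exact Hh | apply Rmin_r]).
    replace (pos d1) with (C * (d1 / C)) by (field; lra).
    apply Rmult_lt_compat_l; lra. }
  assert (Hh' : 0 < Rabs h) by now apply Rabs_pos_lt.
  destruct (Hd (x + h)) as [Ez Lz].
  { change (Rabs (x + h - x) < d); replace (x + h - x) with h by ring; trivial. }
  replace (x + h - x) with h in Lz by ring.
  set (D := phi (x + h) - phi x) in *.
  assert (LD : Rabs D <= C * Rabs h).
  { eapply Rle_trans; [exact Lz |].
    apply Rmult_le_compat_r; [lra |]; unfold C; pose proof (Rle_abs K); lra. }
  assert (Lh : Rabs h <= C * Rabs h).
  { rewrite <- (Rmult_1_l (Rabs h)) at 1; apply Rmult_le_compat_r; lra. }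
  specialize (Hd1 (x + h) (phi (x + h))); fold D in Hd1.
  replace (x + h - x) with h in Hd1 by ring.
  rewrite Ez, H0 in Hd1.
  assert (Hb : Rabs (A * h + B * D) <= eps * B / 2 * Rabs h).
  { replace (A * h + B * D) with (- (0 - 0 - (A * h + B * D))) by ring.
    rewrite Rabs_Ropp.
    eapply Rle_trans; [apply Hd1; lra |].
    replace (eps * B / 2 * Rabs h) with (eps * B / (2 * C) * (C * Rabs h)) by (field; lra).
    apply Rmult_le_compat_l; [lra |].
    now apply Rmax_lub. }
  replace (D / h - - A / B) with ((A * h + B * D) / (B * h)) by (field; split; lra).
  unfold Rdiv; rewrite Rabs_mult, Rabs_inv, Rabs_mult, (Rabs_right B) by lra.
  assert (HBh : 0 < B * Rabs h) by now apply Rmult_lt_0_compat.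
  apply Rmult_lt_reg_r with (B * Rabs h); trivial.
  rewrite Rmult_assoc, Rinv_l, Rmult_1_r by lra.
  eapply Rle_lt_trans; [exact Hb |].
  replace (eps * B / 2 * Rabs h) with (eps * (B * Rabs h) / 2) by field.
  assert (0 < eps * (B * Rabs h)) by now apply Rmult_lt_0_compat.
  lra.
Qed.

Lemma ball_interval_convex x0 r x x' z :
  Rabs (x - x0) < r -> Rabs (x' - x0) < r ->
  Rmin x x' <= z <= Rmax x x' -> Rabs (z - x0) < r.
Proof.
  intros H H' [Hz1 Hz2].
  apply Rabs_def2 in H; apply Rabs_def2 in H'.
  unfold Rmin in Hz1; unfold Rmax in Hz2.
  destruct (Rle_dec x x'); apply Rabs_def1; lra.
Qed.

(** On a small box F increases strictly in y and changes sign between y0 - e and y0 + e, so each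
    vertical line near x0 carries a zero, unique by the Lipschitz bound. *)
Lemma implicit_function_pos F x0 y0 :
  locally_2d (C1_at F) x0 y0 -> F x0 y0 = 0 -> 0 < d_v F x0 y0 ->
  exists phi : R -> R, phi x0 = y0 /\
    locally x0 (fun x => F x (phi x) = 0 /\ C1_at F x (phi x) /\
      d_v F x (phi x) <> 0 /\
      is_derive phi x (- d_u F x (phi x) / d_v F x (phi x))).
Proof.
  intros HC H0 Hv.
  pose proof (locally_2d_singleton _ _ _ HC) as (_ & _ & Cu & Cv).
  (* Half of one partial and one more than the other leave room for both bounds to persist on a box
     around (x0, y0). *)
  set (m := d_v F x0 y0 / 2); set (M := Rabs (d_u F x0 y0) + 1).
  assert (Hm : 0 < m) by (unfold m; lra).
  assert (HM : 0 < M) by (unfold M; pose proof (Rabs_pos (d_u F x0 y0)); lra).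
  assert (Hbox : locally_2d (fun x y => C1_at F x y /\
            Rabs (d_u F x y) <= M /\ m <= d_v F x y) x0 y0).
  { apply locally_2d_and; trivial.
    apply locally_2d_and.
    - generalize (Cu (mkposreal 1 Rlt_0_1)).
      apply locally_2d_impl, locally_2d_forall; cbn [pos]; intros x y H.
      unfold M; pose proof (Rabs_triang (d_u F x y - d_u F x0 y0) (d_u F x0 y0)) as T.
      replace (d_u F x y - d_u F x0 y0 + d_u F x0 y0) with (d_u F x y) in T by ring.
      lra.
    - generalize (Cv (mkposreal m Hm)).
      apply locally_2d_impl, locally_2d_forall; cbn [pos]; intros x y H.
      apply Rabs_def2 in H; unfold m in *; lra. }
  destruct Hbox as [r Hr].
  set (I := fun x => Rabs (x - x0) < r); set (J := fun y => Rabs (y - y0) < r).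
  assert (HI : forall x x' z, I x -> I x' -> Rmin x x' <= z <= Rmax x x' -> I z).
  { intros x x' z; apply ball_interval_convex. }
  assert (HJ : forall x x' z, J x -> J x' -> Rmin x x' <= z <= Rmax x x' -> J z).
  { intros x x' z; apply ball_interval_convex. }
  assert (HF : forall x y, I x -> J y ->
     ex_derive (fun s => F s y) x /\ ex_derive (fun t => F x t) y /\
     Rabs (d_u F x y) <= M /\ m <= d_v F x y).
  { intros x y Ix Jy; destruct (Hr x y Ix Jy) as ((D1 & D2 & _) & B1 & B2); auto. }
  pose proof (zero_set_lipschitz F I J m M HI HJ HF Hm) as Lip.
  assert (HR : 0 < r) by apply cond_pos.
  assert (Ix0 : I x0) by (unfold I; rewrite Rminus_diag, Rabs_R0; trivial).
  assert (Jy0 : J y0) by (unfold J; rewrite Rminus_diag, Rabs_R0; trivial).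
  (* Half the radius keeps y0 - e and y0 + e inside the open interval [J]. *)
  set (e := r / 2).
  assert (Jin : forall y, y0 - e <= y <= y0 + e -> J y).
  { intros y Hy; unfold J, e in *; apply Rabs_def1; lra. }
  assert (Hslope : forall y y', J y -> J y' -> y < y' -> F x0 y < F x0 y').
  { intros y y' Jy Jy' Hyy.
    destruct (MVT_gen (fun t => F x0 t) y y' (fun t => d_v F x0 t)) as (c & Hc & Ec).
    { intros z Hz; refine (Derive_correct _ _ (proj1 (proj2 (HF _ _ _ _)))); trivial.
      apply (HJ y y'); trivial; lra. }
    { intros z Hz; apply continuity_pt_filterlim.
      refine (ex_derive_continuous (fun t => F x0 t) _ (proj1 (proj2 (HF _ _ _ _)))); trivial.
      apply (HJ y y'); trivial; lra. }
    destruct (HF x0 c Ix0 (HJ _ _ _ Jy Jy' Hc)) as (_ & _ & _ & B).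
    assert (0 < d_v F x0 c * (y' - y)) by (apply Rmult_lt_0_compat; lra).
    lra. }
  assert (Ju : J (y0 + e)) by (apply Jin; unfold e; lra).
  assert (Jl : J (y0 - e)) by (apply Jin; unfold e; lra).
  assert (Hup : 0 < F x0 (y0 + e)).
  { rewrite <- H0; apply Hslope; trivial; unfold e; lra. }
  assert (Hlo : F x0 (y0 - e) < 0).
  { rewrite <- H0; apply Hslope; trivial; unfold e; lra. }
  assert (Lup : locally x0 (fun x => 0 < F x (y0 + e))).
  { assert (Cc : continuous (fun s => F s (y0 + e)) x0).
    { refine (ex_derive_continuous (fun s => F s (y0 + e)) _ (proj1 (HF _ _ _ _))); trivial. }
    exact (Cc _ (open_gt 0 _ Hup)). }
  assert (Llo : locally x0 (fun x => F x (y0 - e) < 0)).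
  { assert (Cc : continuous (fun s => F s (y0 - e)) x0).
    { refine (ex_derive_continuous (fun s => F s (y0 - e)) _ (proj1 (HF _ _ _ _))); trivial. }
    exact (Cc _ (open_lt 0 _ Hlo)). }
  assert (LI : locally x0 I) by (exists r; intros y Hy; exact Hy).
  assert (Lex : locally x0 (fun x => I x /\ exists y, J y /\ F x y = 0)).
  { generalize (filter_and _ _ LI (filter_and _ _ Lup Llo)).
    apply filter_imp; intros x (Ix & Hxu & Hxl); split; trivial.
    destruct (IVT_interv (fun t => F x t) (y0 - e) (y0 + e)) as (z & Hz & Ez); trivial.
    - intros a Ha; apply continuity_pt_filterlim.
      refine (ex_derive_continuous (fun t => F x t) _ (proj1 (proj2 (HF _ _ _ _)))); auto.
    - unfold e; lra.
    - exists z; auto. }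
  (* The value is unspecified where no zero exists; all later claims are local at x0, where one
     does. *)
  set (phi := fun x => epsilon (inhabits 0) (fun y => J y /\ F x y = 0)).
  assert (Lphi : locally x0 (fun x => I x /\ J (phi x) /\ F x (phi x) = 0)).
  { revert Lex; apply filter_imp; intros x (Ix & Hx); split; trivial.
    exact (epsilon_spec (inhabits 0) _ Hx). }
  exists phi; split.
  - destruct (locally_singleton _ _ Lphi) as (_ & Jp & Ep).
    pose proof (Lip _ _ _ _ Ix0 Jy0 Ix0 Jp H0 Ep) as L.
    rewrite Rminus_diag, Rabs_R0, Rmult_0_r in L.
    destruct (Req_dec (phi x0) y0) as [|N]; trivial.
    assert (0 < m * Rabs (phi x0 - y0)).
    { apply Rmult_lt_0_compat; trivial; apply Rabs_pos_lt; lra. }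
    lra.
  (* The derivative is wanted at every x near x0, so the neighbourhoods are recentred at (x, phi
     x). *)
  - generalize (locally_locally _ _ Lphi); apply filter_imp; intros x Lx.
    destruct (locally_singleton _ _ Lx) as (Ix & Jx & Ex).
    destruct (Hr _ _ Ix Jx) as (Cx & _ & Bx).
    refine (conj Ex (conj Cx (conj _ _))); [lra |].
    apply (implicit_derivative F phi x (M / m)); trivial; try lra.
    + apply locally_2d_locally.
      assert (OI : locally x I).
      { revert Lx; apply filter_imp; tauto. }
      assert (OJ : locally (phi x) J).
      { assert (Hq : 0 < r - Rabs (phi x - y0)) by (unfold J in Jx; lra).
        exists (mkposreal _ Hq); intros y Hy.
        change (Rabs (y - phi x) < r - Rabs (phi x - y0)) in Hy; unfold J.
        replace (y - y0) with ((y - phi x) + (phi x - y0)) by ring.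
        pose proof (Rabs_triang (y - phi x) (phi x - y0)); lra. }
      destruct OI as [d1 O1]; destruct OJ as [d2 O2].
      assert (Hd : 0 < Rmin d1 d2) by (apply Rmin_pos; apply cond_pos).
      exists (mkposreal _ Hd); intros [a b] [Ha Hb]; cbn in *.
      apply Hr; [apply O1 | apply O2].
      * eapply Rlt_le_trans; [exact Ha | apply Rmin_l].
      * eapply Rlt_le_trans; [exact Hb | apply Rmin_r].
    + revert Lx; apply filter_imp; intros z (Iz & Jz & Ez); split; trivial.
      pose proof (Lip _ _ _ _ Ix Jx Iz Jz Ex Ez) as L.
      apply Rmult_le_reg_l with m; trivial.
      replace (m * (M / m * Rabs (z - x))) with (M * Rabs (z - x)) by (field; lra).
      exact L.
Qed.

(** A negative slope is reduced to a positive one by passing to -F, which has the same zeros and the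
    same quotient of partials. *)
Lemma implicit_function F x0 y0 :
  locally_2d (C1_at F) x0 y0 -> F x0 y0 = 0 -> d_v F x0 y0 <> 0 ->
  exists phi : R -> R, phi x0 = y0 /\
    locally x0 (fun x => F x (phi x) = 0 /\ C1_at F x (phi x) /\
      d_v F x (phi x) <> 0 /\
      is_derive phi x (- d_u F x (phi x) / d_v F x (phi x))).
Proof.
  intros HC H0 Hv.
  destruct (Rlt_dec 0 (d_v F x0 y0)) as [Hp | Hn].
  { now apply implicit_function_pos. }
  assert (Ev : forall x y, d_v (fun x y => - F x y) x y = - d_v F x y)
    by (intros; apply Derive_opp).
  assert (Eu : forall x y, d_u (fun x y => - F x y) x y = - d_u F x y)
    by (intros; apply Derive_opp).
  destruct (implicit_function_pos (fun x y => - F x y) x0 y0) as (phi & P0 & HP).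
  - revert HC; apply locally_2d_impl, locally_2d_forall; intros; now apply C1_at_opp.
  - rewrite H0; ring.
  - rewrite Ev; lra.
  - exists phi; split; trivial.
    revert HP; apply filter_imp; intros x (E & C & N & D).
    rewrite Ev in N, D; rewrite Eu in D.
    refine (conj _ (conj _ (conj _ _))); [lra | | lra |].
    + apply (C1_at_ext (fun x y => - - F x y)); [intros; ring | now apply C1_at_opp].
    + replace (- d_u F x (phi x) / d_v F x (phi x))
        with (- - d_u F x (phi x) / - d_v F x (phi x)) by (field; lra).
      exact D.
Qed.

(** * Velocities of paths in a regular zero set *)

Lemma continuous_pair {T V W : UniformSpace} (f : T -> V) (g : T -> W) x :
  continuous f x -> continuous g x -> continuous (fun z => (f z, g z)) x.
Proof.
  intros Hf Hg; apply (continuous_comp_2 f g pair); trivial.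
  apply (continuous_ext (fun z => z)); [intros [] | apply continuous_id]; trivial.
Qed.

(** For X = (a, b) the path is t -> (x0 + t a, phi (x0 + t a)). Its velocity has second component -
    a F_u / F_v, which is b because dF(X) = 0. Openness of U keeps the path in U for small t. *)
Lemma tangent_vector_of_graph (U : R * R -> Prop) F p X :
  open U -> (forall q, U q -> C1_at F (fst q) (snd q)) ->
  U p -> F (fst p) (snd p) = 0 -> d_v F (fst p) (snd p) <> 0 ->
  differential F p X = 0 ->
  tangent_vector (fun q => U q /\ F (fst q) (snd q) = 0) p X.
Proof.
  destruct p as [x0 y0]; destruct X as [a b]; unfold differential; cbn [fst snd].
  intros HU HC Hp H0 Hv Hd.
  assert (LC : locally_2d (C1_at F) x0 y0).
  { apply locally_2d_locally; generalize (HU _ Hp); apply filter_imp.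
    intros q Hq; now apply HC. }
  destruct (implicit_function F x0 y0 LC H0 Hv) as (phi & P0 & HP).
  set (h := fun t => x0 + t * a).
  assert (Dh : forall t, is_derive h t a).
  { intros t; unfold h; auto_derive; [trivial | ring]. }
  assert (h0 : h 0 = x0) by (unfold h; ring).
  assert (Ch : continuous h 0) by (apply (ex_derive_continuous h); exists a; apply Dh).
  assert (LU : locally x0 (fun x => U (x, phi x))).
  { destruct (locally_singleton _ _ HP) as (_ & _ & _ & D).
    assert (Cp : continuous phi x0) by (apply (ex_derive_continuous phi); eexists; exact D).
    assert (Cg : continuous (fun x => (x, phi x)) x0).
    { now apply continuous_pair; [apply continuous_id |]. }
    apply Cg; rewrite P0; now apply HU. }
  assert (LL : locally 0 (fun t => U (h t, phi (h t)) /\ F (h t) (phi (h t)) = 0 /\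
             C1_at F (h t) (phi (h t)) /\ d_v F (h t) (phi (h t)) <> 0 /\
             is_derive phi (h t) (- d_u F (h t) (phi (h t)) / d_v F (h t) (phi (h t))))).
  { apply (Ch (fun x => U (x, phi x) /\ F x (phi x) = 0 /\ C1_at F x (phi x) /\
      d_v F x (phi x) <> 0 /\ is_derive phi x (- d_u F x (phi x) / d_v F x (phi x)))).
    rewrite h0; now apply filter_and. }
  assert (Dg : forall t,
            is_derive phi (h t) (- d_u F (h t) (phi (h t)) / d_v F (h t) (phi (h t))) ->
            is_derive (fun t => phi (h t)) t
              (a * (- d_u F (h t) (phi (h t)) / d_v F (h t) (phi (h t))))).
  { intros t D; exact (is_derive_comp phi h t _ _ D (Dh t)). }
  exists h, (fun t => phi (h t)); repeat split.
  - now rewrite h0, P0.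
  - f_equal.
    + apply is_derive_unique, Dh.
    + destruct (locally_singleton _ _ LL) as (_ & _ & _ & _ & D).
      etransitivity; [apply is_derive_unique, (Dg 0 D) |]; rewrite h0, P0.
      apply Rmult_eq_reg_l with (d_v F x0 y0); trivial.
      replace (d_v F x0 y0 * (a * (- d_u F x0 y0 / d_v F x0 y0)))
        with (- (d_u F x0 y0 * a)) by (field; trivial).
      lra.
  - generalize (locally_locally _ _ LL); apply filter_imp; intros t Lt.
    destruct (locally_singleton _ _ Lt) as (Ut & Et & (_ & _ & Cu & Cv) & N & D).
    assert (Cht : continuous h t) by (apply (ex_derive_continuous h); exists a; apply Dh).
    assert (Cpt : continuous (fun t => phi (h t)) t).
    { apply (ex_derive_continuous (fun t => phi (h t))); eexists; apply Dg, D. }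
    repeat split; trivial.
    + exists a; apply Dh.
    + eexists; apply Dg, D.
    + apply (continuous_ext (fun _ => a)); [| apply continuous_const].
      intros x; symmetry; apply is_derive_unique, Dh.
    (* Near t the derivative equals the quotient of partials along the path, and this quotient is
       continuous. *)
    + apply (continuous_ext_loc _
        (fun t => a * (- d_u F (h t) (phi (h t)) * / d_v F (h t) (phi (h t))))).
      { revert Lt; apply filter_imp; intros z (_ & _ & _ & _ & Dz).
        symmetry; apply is_derive_unique, Dg, Dz. }
      apply (continuous_mult (fun _ => a)); [apply continuous_const |].
      apply (continuous_mult (fun t => - d_u F (h t) (phi (h t)))).
      * apply (continuous_opp (fun t => d_u F (h t) (phi (h t)))).
        apply (continuous_comp_2 h (fun t => phi (h t)) (d_u F)); trivial.
        now apply continuity_2d_pt_filterlim.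
      * apply continuous_Rinv_comp; trivial.
        apply (continuous_comp_2 h (fun t => phi (h t)) (d_v F)); trivial.
        now apply continuity_2d_pt_filterlim.
Qed.

Lemma continuous_swap (p : R * R) :
  continuous (fun q : R * R => (snd q, fst q)) p.
Proof.
  destruct p as [x y].
  apply continuous_pair.
  - apply continuous_snd.
  - apply continuous_fst.
Qed.

(** If F_v vanishes at p, then F_u does not, and exchanging the coordinates leads back to a
    graph. *)
Lemma tangent_vector_zero_set (U : R * R -> Prop) F p X :
  open U -> (forall q, U q -> C1_at F (fst q) (snd q)) ->
  U p -> F (fst p) (snd p) = 0 -> (exists Z, differential F p Z <> 0) ->
  differential F p X = 0 ->
  tangent_vector (fun q => U q /\ F (fst q) (snd q) = 0) p X.
Proof.
  intros HU HC Hp H0 [Z HZ] HX.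
  destruct (Req_dec (d_v F (fst p) (snd p)) 0) as [Ev | Nv].
  2: now apply tangent_vector_of_graph.
  destruct (tangent_vector_of_graph (fun q => U (snd q, fst q)) (fun x y => F y x)
              (snd p, fst p) (snd X, fst X)) as (g1 & g2 & E1 & E2 & L).
  - intros q Hq; exact (continuous_swap q _ (HU _ Hq)).
  - intros [x y] Hq; exact (C1_at_swap _ _ _ (HC _ Hq)).
  - now destruct p.
  - exact H0.
  - change (d_u F (fst p) (snd p) <> 0); intros Eu.
    apply HZ; unfold differential; rewrite Eu, Ev; ring.
  - rewrite <- HX; apply Rplus_comm.
  - destruct p as [x y]; destruct X as [a b]; cbn [fst snd] in *.
    injection E1 as E11 E12; injection E2 as E21 E22.
    exists g2, g1; repeat split; try congruence.
    revert L; apply filter_imp; intros t; cbn [fst snd]; tauto.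
Qed.

(** * Limits of zeros, and the algebra of 2x2 matrices *)

Lemma closure_zero (A : R * R -> Prop) G p :
  continuity_2d_pt G (fst p) (snd p) -> closure A p ->
  (forall q, A q -> G (fst q) (snd q) = 0) -> G (fst p) (snd p) = 0.
Proof.
  destruct p as [u v]; cbn [fst snd]; intros HC Hcl HA.
  destruct (Req_dec (G u v) 0) as [| N]; trivial.
  pose proof (HC (mkposreal _ (Rabs_pos_lt _ N))) as L.
  apply locally_2d_locally in L.
  destruct (Hcl _ L) as ([x y] & Hq & Aq); cbn [pos fst snd] in Hq.
  rewrite (HA _ Aq : G x y = 0), Rminus_0_l, Rabs_Ropp in Hq; lra.
Qed.

(* Up to sign, (b, l - a) and (l - d, c) are the columns of the adjugate of S - l. *)
Lemma eigenvector_adjugate a b c d l x y :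
  (x, y) <> (0, 0) ->
  a * x + b * y = l * x -> c * x + d * y = l * y ->
  (a - l) * (d - l) - b * c = 0 /\
  (exists k, b = k * x /\ l - a = k * y) /\
  (exists k, l - d = k * x /\ c = k * y).
Proof.
  intros N E1 E2.
  assert (N' : x <> 0 \/ y <> 0).
  { destruct (Req_dec x 0); [right | now left]; intros ->; apply N; congruence. }
  (* Cramer's rule: applying the adjugate to (S - l) X = 0 shows that the determinant kills both
     coordinates of X. *)
  assert (Ex : ((a - l) * (d - l) - b * c) * x = 0).
  { replace (((a - l) * (d - l) - b * c) * x)
      with ((d - l) * (a * x + b * y - l * x) - b * (c * x + d * y - l * y)) by ring.
    rewrite E1, E2; ring. }
  assert (Ey : ((a - l) * (d - l) - b * c) * y = 0).
  { replace (((a - l) * (d - l) - b * c) * y)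
      with ((a - l) * (c * x + d * y - l * y) - c * (a * x + b * y - l * x)) by ring.
    rewrite E1, E2; ring. }
  destruct N' as [Nx | Ny]; repeat split.
  - apply Rmult_integral in Ex; tauto.
  - exists (b / x); split; [now field |].
    apply Rmult_eq_reg_r with x; trivial; field_simplify; trivial; lra.
  - exists ((l - d) / x); split; [now field |].
    apply Rmult_eq_reg_r with x; trivial; field_simplify; trivial; lra.
  - apply Rmult_integral in Ey; tauto.
  - exists ((l - a) / y); split; [| now field].
    apply Rmult_eq_reg_r with y; trivial; field_simplify; trivial; lra.
  - exists (c / y); split; [| now field].
    apply Rmult_eq_reg_r with y; trivial; field_simplify; trivial; lra.
Qed.

Lemma is_derive_discriminant (a b c d : R -> R) t :
  ex_derive a t -> ex_derive b t -> ex_derive c t -> ex_derive d t ->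
  is_derive (fun t => (a t - d t) ^ 2 + 4 * b t * c t) t
    (2 * (a t - d t) * (Derive a t - Derive d t)
     + 4 * (Derive b t * c t + b t * Derive c t)).
Proof.
  intros; auto_derive; [tauto |].
  change (fun x => a x) with a; change (fun x => b x) with b.
  change (fun x => c x) with c; change (fun x => d x) with d; ring.
Qed.

(** * Regularity of the shape operator, its trace and its discriminant *)

(** The entries of S are negated first partials, so their being C^1 is read off from [ex_diff_n] at
    order 2. *)
Lemma smooth_on_entry (U : R * R -> Prop) f p :
  smooth_on U f -> U p ->
  C1_at (fun u v => - d_u f u v) (fst p) (snd p) /\
  C1_at (fun u v => - d_v f u v) (fst p) (snd p).
Proof.
  intros Hf Hp; destruct (Hf p Hp 2%nat) as (_ & _ & _ & Hu & Hv).
  destruct Hu as (_ & U1 & U2 & (U3 & _) & (U4 & _)).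
  destruct Hv as (_ & V1 & V2 & (V3 & _) & (V4 & _)).
  split; apply C1_at_opp; repeat split; assumption.
Qed.

Lemma C1_at_continuity f u v : locally_2d (C1_at f) u v -> continuity_2d_pt f u v.
Proof.
  intros H; apply continuity_2d_pt_filterlim.
  apply (filterdiff_continuous (fun z : R * R => f (fst z) (snd z)) (u, v)).
  eexists; apply filterdiff_differentiable_pt_lim, C1_at_differentiable, H.
Qed.

Definition trace (xi1 xi2 : R -> R -> R) (u v : R) : R :=
  S11 xi1 xi2 u v + S22 xi1 xi2 u v.

(** Every term of this formula contains an undifferentiated factor a - d, b or c. It serves for the
    continuity of the partials and for the vanishing of dD where S is scalar. *)
Lemma d_u_discriminant U xi1 xi2 u v :
  smooth_on U xi1 -> smooth_on U xi2 -> U (u, v) ->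
  d_u (discriminant xi1 xi2) u v =
    2 * (S11 xi1 xi2 u v - S22 xi1 xi2 u v)
      * (d_u (S11 xi1 xi2) u v - d_u (S22 xi1 xi2) u v)
    + 4 * (d_u (S12 xi1 xi2) u v * S21 xi1 xi2 u v
           + S12 xi1 xi2 u v * d_u (S21 xi1 xi2) u v).
Proof.
  intros H1 H2 Hp.
  destruct (smooth_on_entry U xi1 _ H1 Hp) as [(A & _) (B & _)].
  destruct (smooth_on_entry U xi2 _ H2 Hp) as [(C & _) (D & _)].
  apply is_derive_unique.
  exact (is_derive_discriminant (fun s => S11 xi1 xi2 s v) (fun s => S12 xi1 xi2 s v)
    (fun s => S21 xi1 xi2 s v) (fun s => S22 xi1 xi2 s v) u A B C D).
Qed.

Lemma d_v_discriminant U xi1 xi2 u v :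
  smooth_on U xi1 -> smooth_on U xi2 -> U (u, v) ->
  d_v (discriminant xi1 xi2) u v =
    2 * (S11 xi1 xi2 u v - S22 xi1 xi2 u v)
      * (d_v (S11 xi1 xi2) u v - d_v (S22 xi1 xi2) u v)
    + 4 * (d_v (S12 xi1 xi2) u v * S21 xi1 xi2 u v
           + S12 xi1 xi2 u v * d_v (S21 xi1 xi2) u v).
Proof.
  intros H1 H2 Hp.
  destruct (smooth_on_entry U xi1 _ H1 Hp) as [(_ & A & _) (_ & B & _)].
  destruct (smooth_on_entry U xi2 _ H2 Hp) as [(_ & C & _) (_ & D & _)].
  apply is_derive_unique.
  exact (is_derive_discriminant (fun s => S11 xi1 xi2 u s) (fun s => S12 xi1 xi2 u s)
    (fun s => S21 xi1 xi2 u s) (fun s => S22 xi1 xi2 u s) v A B C D).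
Qed.

Lemma open_locally_2d (U : R * R -> Prop) u v :
  open U -> U (u, v) -> locally_2d (fun x y => U (x, y)) u v.
Proof.
  intros HU Hp; apply locally_2d_locally; generalize (HU _ Hp).
  apply filter_imp; now intros [x y].
Qed.

Lemma C1_at_S U xi1 xi2 u v :
  smooth_on U xi1 -> smooth_on U xi2 -> U (u, v) ->
  C1_at (S11 xi1 xi2) u v /\ C1_at (S12 xi1 xi2) u v /\
  C1_at (S21 xi1 xi2) u v /\ C1_at (S22 xi1 xi2) u v.
Proof.
  intros H1 H2 Hp.
  destruct (smooth_on_entry U xi1 _ H1 Hp) as [A B].
  destruct (smooth_on_entry U xi2 _ H2 Hp) as [C D].
  repeat split; first [apply A | apply B | apply C | apply D].
Qed.

Lemma continuity_S U xi1 xi2 u v :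
  open U -> smooth_on U xi1 -> smooth_on U xi2 -> U (u, v) ->
  continuity_2d_pt (S11 xi1 xi2) u v /\ continuity_2d_pt (S12 xi1 xi2) u v /\
  continuity_2d_pt (S21 xi1 xi2) u v /\ continuity_2d_pt (S22 xi1 xi2) u v.
Proof.
  intros HU H1 H2 Hp; pose proof (open_locally_2d _ _ _ HU Hp) as L.
  repeat split; apply C1_at_continuity; revert L;
    apply locally_2d_impl, locally_2d_forall; intros x y Hq;
    apply (C1_at_S U xi1 xi2 x y H1 H2 Hq).
Qed.

Ltac continuity_2d :=
  repeat first
    [ assumption
    | apply continuity_2d_pt_const
    | apply continuity_2d_pt_plus
    | apply continuity_2d_pt_minus
    | apply continuity_2d_pt_opp
    | apply continuity_2d_pt_mult ].

Lemma C1_at_discriminant U xi1 xi2 u v :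
  open U -> smooth_on U xi1 -> smooth_on U xi2 -> U (u, v) ->
  C1_at (discriminant xi1 xi2) u v.
Proof.
  intros HU H1 H2 Hp; pose proof (open_locally_2d _ _ _ HU Hp) as L.
  destruct (C1_at_S U xi1 xi2 u v H1 H2 Hp)
    as ((A1 & A2 & A3 & A4) & (B1 & B2 & B3 & B4) & (C1 & C2 & C3 & C4) & (D1 & D2 & D3 & D4)).
  destruct (continuity_S U xi1 xi2 u v HU H1 H2 Hp) as (A & B & C & D).
  repeat split.
  - eexists; exact (is_derive_discriminant (fun s => S11 xi1 xi2 s v)
      (fun s => S12 xi1 xi2 s v) (fun s => S21 xi1 xi2 s v)
      (fun s => S22 xi1 xi2 s v) u A1 B1 C1 D1).
  - eexists; exact (is_derive_discriminant (fun s => S11 xi1 xi2 u s)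
      (fun s => S12 xi1 xi2 u s) (fun s => S21 xi1 xi2 u s)
      (fun s => S22 xi1 xi2 u s) v A2 B2 C2 D2).
  (* The explicit formula is available at points of U only, so it replaces the partial only near (u,
     v). *)
  - apply (continuity_2d_pt_ext_loc (fun x y =>
      2 * (S11 xi1 xi2 x y - S22 xi1 xi2 x y)
        * (d_u (S11 xi1 xi2) x y - d_u (S22 xi1 xi2) x y)
      + 4 * (d_u (S12 xi1 xi2) x y * S21 xi1 xi2 x y
             + S12 xi1 xi2 x y * d_u (S21 xi1 xi2) x y))); [| continuity_2d].
    revert L; apply locally_2d_impl, locally_2d_forall; intros x y Hq.
    symmetry; exact (d_u_discriminant U xi1 xi2 x y H1 H2 Hq).
  - apply (continuity_2d_pt_ext_loc (fun x y =>
      2 * (S11 xi1 xi2 x y - S22 xi1 xi2 x y)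
        * (d_v (S11 xi1 xi2) x y - d_v (S22 xi1 xi2) x y)
      + 4 * (d_v (S12 xi1 xi2) x y * S21 xi1 xi2 x y
             + S12 xi1 xi2 x y * d_v (S21 xi1 xi2) x y))); [| continuity_2d].
    revert L; apply locally_2d_impl, locally_2d_forall; intros x y Hq.
    symmetry; exact (d_v_discriminant U xi1 xi2 x y H1 H2 Hq).
Qed.

Lemma continuity_discriminant U xi1 xi2 u v :
  open U -> smooth_on U xi1 -> smooth_on U xi2 -> U (u, v) ->
  continuity_2d_pt (discriminant xi1 xi2) u v.
Proof.
  intros HU H1 H2 Hp; apply C1_at_continuity.
  generalize (open_locally_2d _ _ _ HU Hp).
  apply locally_2d_impl, locally_2d_forall.
  intros x y Hq; now apply (C1_at_discriminant U).
Qed.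

(** [sqrt] is 0 on negative numbers and hence continuous on the whole line, so this also holds on
    the discriminant curve, where the limit is taken. *)
Lemma continuity_sqrt_discriminant U xi1 xi2 u v :
  open U -> smooth_on U xi1 -> smooth_on U xi2 -> U (u, v) ->
  continuity_2d_pt (fun x y => sqrt (discriminant xi1 xi2 x y)) u v.
Proof.
  intros HU H1 H2 Hp; apply (continuity_1d_2d_pt_comp sqrt).
  - apply continuity_pt_filterlim, continuous_sqrt.
  - now apply (continuity_discriminant U).
Qed.

Lemma C1_at_trace U xi1 xi2 u v :
  open U -> smooth_on U xi1 -> smooth_on U xi2 -> U (u, v) ->
  C1_at (trace xi1 xi2) u v.
Proof.
  intros HU H1 H2 Hp; pose proof (open_locally_2d _ _ _ HU Hp) as L.
  destruct (C1_at_S U xi1 xi2 u v H1 H2 Hp)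
    as ((A1 & A2 & A3 & A4) & _ & _ & (D1 & D2 & D3 & D4)).
  repeat split.
  - exact (ex_derive_plus (fun s => S11 xi1 xi2 s v) (fun s => S22 xi1 xi2 s v) u A1 D1).
  - exact (ex_derive_plus (fun s => S11 xi1 xi2 u s) (fun s => S22 xi1 xi2 u s) v A2 D2).
  - apply (continuity_2d_pt_ext_loc
      (fun x y => d_u (S11 xi1 xi2) x y + d_u (S22 xi1 xi2) x y)); [| continuity_2d].
    revert L; apply locally_2d_impl, locally_2d_forall; intros x y Hq.
    destruct (C1_at_S U xi1 xi2 x y H1 H2 Hq) as ((E & _) & _ & _ & (E' & _)).
    symmetry; exact (Derive_plus _ _ _ E E').
  - apply (continuity_2d_pt_ext_loc
      (fun x y => d_v (S11 xi1 xi2) x y + d_v (S22 xi1 xi2) x y)); [| continuity_2d].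
    revert L; apply locally_2d_impl, locally_2d_forall; intros x y Hq.
    destruct (C1_at_S U xi1 xi2 x y H1 H2 Hq) as ((_ & E & _) & _ & _ & (_ & E' & _)).
    symmetry; exact (Derive_plus _ _ _ E E').
Qed.

(** * Eigenvalues and ridge points near the discriminant curve *)

(** The first equation is the characteristic equation with the square completed: 4 det (S - l) = (2
    l - T)^2 - D. *)
Lemma eigenvector_shape xi1 xi2 u v l X :
  eigenvector xi1 xi2 (u, v) l X ->
  (2 * l - trace xi1 xi2 u v) ^ 2 = discriminant xi1 xi2 u v /\
  (exists k, S12 xi1 xi2 u v = k * fst X /\ l - S11 xi1 xi2 u v = k * snd X) /\
  (exists k, l - S22 xi1 xi2 u v = k * fst X /\ S21 xi1 xi2 u v = k * snd X).
Proof.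
  destruct X as [x y]; intros [N E]; injection E as E1 E2; cbn [fst snd] in *.
  destruct (eigenvector_adjugate _ _ _ _ _ _ _ N E1 E2) as (P & K & K').
  split; [| now split].
  unfold trace, discriminant; apply Rminus_diag_uniq; rewrite <- (Rmult_0_r 4), <- P; ring.
Qed.

(** With r = sqrt D > 0, both eigenvalues are roots of (2 l - T - r) (2 l - T + r), and their strict
    order leaves one assignment. The factors [1] and [-1] prepare the uniform treatment by a sign
    s. *)
Lemma ordered_eigenvalues_formula U xi1 xi2 l1 l2 :
  ordered_eigenvalues U xi1 xi2 l1 l2 ->
  forall u v, hyperbolic_region U xi1 xi2 (u, v) ->
  l1 u v = (trace xi1 xi2 u v + 1 * sqrt (discriminant xi1 xi2 u v)) / 2 /\
  l2 u v = (trace xi1 xi2 u v + -1 * sqrt (discriminant xi1 xi2 u v)) / 2.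
Proof.
  intros HO u v Hq; destruct (HO _ Hq) as ([X1 E1] & [X2 E2] & Lt).
  cbn [fst snd] in *; destruct Hq as [_ Hd]; cbn [fst snd] in Hd.
  destruct (eigenvector_shape _ _ _ _ _ _ E1) as (Q1 & _).
  destruct (eigenvector_shape _ _ _ _ _ _ E2) as (Q2 & _).
  pose proof (sqrt_lt_R0 _ Hd) as Hr.
  rewrite <- (pow2_sqrt _ (Rlt_le _ _ Hd)) in Q1, Q2.
  set (r := sqrt (discriminant xi1 xi2 u v)) in *.
  set (T := trace xi1 xi2 u v) in *.
  assert (P1 : (2 * l1 u v - T - r) * (2 * l1 u v - T + r) = 0) by lra.
  assert (P2 : (2 * l2 u v - T - r) * (2 * l2 u v - T + r) = 0) by lra.
  apply Rmult_integral in P1; apply Rmult_integral in P2; lra.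
Qed.

(* Clearing denominators in [2 dl = dT + s dD / (2 sqrt D)]. *)
Lemma ridge_point_equation U xi1 xi2 u v :
  open U -> smooth_on U xi1 -> smooth_on U xi2 ->
  ridge_point U xi1 xi2 (u, v) ->
  exists s X, (s = 1 \/ s = -1) /\
    eigenvector xi1 xi2 (u, v)
      ((trace xi1 xi2 u v + s * sqrt (discriminant xi1 xi2 u v)) / 2) X /\
    s * differential (discriminant xi1 xi2) (u, v) X
    + 2 * sqrt (discriminant xi1 xi2 u v) * differential (trace xi1 xi2) (u, v) X = 0.
Proof.
  intros HU H1 H2 (Hh & l1 & l2 & HO & l & Hl & X & HX & HdX).
  cbn [fst snd] in HX.
  pose proof (ordered_eigenvalues_formula _ _ _ _ _ HO) as Hf.
  assert (Hs : exists s, (s = 1 \/ s = -1) /\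
            forall x y, hyperbolic_region U xi1 xi2 (x, y) ->
            l x y = (trace xi1 xi2 x y + s * sqrt (discriminant xi1 xi2 x y)) / 2).
  { destruct Hl as [-> | ->]; [exists 1 | exists (-1)];
      (split; [tauto | intros x y Hq; apply Hf, Hq]). }
  destruct Hs as (s & Hs & Hls); exists s, X.
  pose proof Hh as [HUq Hd]; cbn [fst snd] in Hd.
  pose proof (C1_at_discriminant U xi1 xi2 u v HU H1 H2 HUq) as (Du & Dv & _).
  pose proof (C1_at_trace U xi1 xi2 u v HU H1 H2 HUq) as (Tu & Tv & _).
  (* The region D > 0 is open, so the formula for [l] holds near (u, v) and may be
     differentiated. *)
  assert (LD : locally_2d (fun x y => hyperbolic_region U xi1 xi2 (x, y)) u v).
  { pose proof (open_locally_2d _ _ _ HU HUq) as LU.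
    apply locally_2d_and; trivial.
    generalize (continuity_discriminant U xi1 xi2 u v HU H1 H2 HUq (mkposreal _ Hd)).
    apply locally_2d_impl, locally_2d_forall.
    cbn [pos fst snd]; intros x y B; apply Rabs_def2 in B; lra. }
  pose proof (sqrt_lt_R0 _ Hd) as Hr.
  split; [exact Hs |]; split; [now rewrite <- (Hls _ _ Hh) |].
  unfold differential in *; cbn [fst snd] in *.
  set (r := sqrt (discriminant xi1 xi2 u v)) in *.
  assert (Eu : d_u l u v = (d_u (trace xi1 xi2) u v
                 + s * (d_u (discriminant xi1 xi2) u v / (2 * r))) / 2).
  { etransitivity.
    { apply Derive_ext_loc; generalize (locally_2d_1d_const_y _ _ _ LD).
      apply filter_imp; intros x Hq; apply Hls, Hq. }
    apply is_derive_unique; cbv beta.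
    pose proof (is_derive_sqrt _ _ _ (Derive_correct _ _ Du) Hd) as Ds.
    pose proof (is_derive_plus _ _ _ _ _ (Derive_correct _ _ Tu)
                  (is_derive_scal _ _ s _ Ds)) as Dp.
    pose proof (is_derive_scal _ _ (/ 2) _ Dp) as Dh.
    eapply is_derive_ext; [| unfold Rdiv; rewrite Rmult_comm; exact Dh].
    intros t; cbv beta; apply Rmult_comm. }
  assert (Ev : d_v l u v = (d_v (trace xi1 xi2) u v
                 + s * (d_v (discriminant xi1 xi2) u v / (2 * r))) / 2).
  { etransitivity.
    { apply Derive_ext_loc; generalize (locally_2d_1d_const_x _ _ _ LD).
      apply filter_imp; intros x Hq; apply Hls, Hq. }
    apply is_derive_unique; cbv beta.
    pose proof (is_derive_sqrt _ _ _ (Derive_correct _ _ Dv) Hd) as Ds.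
    pose proof (is_derive_plus _ _ _ _ _ (Derive_correct _ _ Tv)
                  (is_derive_scal _ _ s _ Ds)) as Dp.
    pose proof (is_derive_scal _ _ (/ 2) _ Dp) as Dh.
    eapply is_derive_ext; [| unfold Rdiv; rewrite Rmult_comm; exact Dh].
    intros t; cbv beta; apply Rmult_comm. }
  rewrite Eu, Ev in HdX.
  rewrite <- (Rmult_0_r (4 * r)), <- HdX; field; lra.
Qed.

(** For each sign s, (w1 s, w2 s) stands for a continuous field of multiples, possibly zero, of the
    eigenvectors for (T + s sqrt D) / 2; the two fields meet at the limit point. It is applied to
    both adjugate columns. *)
Lemma closure_ridge_differential U xi1 xi2 u v (w1 w2 : R -> R -> R -> R) :
  open U -> smooth_on U xi1 -> smooth_on U xi2 -> U (u, v) ->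
  discriminant xi1 xi2 u v = 0 -> closure (ridge_point U xi1 xi2) (u, v) ->
  (forall s, continuity_2d_pt (w1 s) u v /\ continuity_2d_pt (w2 s) u v) ->
  (forall s x y X,
     eigenvector xi1 xi2 (x, y)
       ((trace xi1 xi2 x y + s * sqrt (discriminant xi1 xi2 x y)) / 2) X ->
     exists k, w1 s x y = k * fst X /\ w2 s x y = k * snd X) ->
  w1 1 u v = w1 (-1) u v -> w2 1 u v = w2 (-1) u v ->
  differential (discriminant xi1 xi2) (u, v) (w1 1 u v, w2 1 u v) = 0.
Proof.
  intros HU H1 H2 Hp Hd Hcl Hc Hw E1 E2.
  set (D := discriminant xi1 xi2) in *; set (T := trace xi1 xi2) in *.
  set (G := fun s x y =>
    s * (d_u D x y * w1 s x y + d_v D x y * w2 s x y)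
    + 2 * sqrt (D x y) * (d_u T x y * w1 s x y + d_v T x y * w2 s x y)).
  (* Both eigenvalues may have ridge points accumulating at (u, v); the product
     over the two signs vanishes on all of them. *)
  assert (HG : G 1 u v * G (-1) u v = 0).
  { apply (closure_zero _ (fun x y => G 1 x y * G (-1) x y) (u, v)) in Hcl; trivial.
    - pose proof (C1_at_discriminant U xi1 xi2 u v HU H1 H2 Hp) as (_ & _ & Du & Dv).
      pose proof (C1_at_trace U xi1 xi2 u v HU H1 H2 Hp) as (_ & _ & Tu & Tv).
      fold D in Du, Dv; fold T in Tu, Tv.
      pose proof (continuity_sqrt_discriminant U xi1 xi2 u v HU H1 H2 Hp) as Cr.
      fold D in Cr.
      destruct (Hc 1) as [P1 P2]; destruct (Hc (-1)) as [Q1 Q2].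
      cbn [fst snd]; unfold G; continuity_2d.
    - intros [x y] HR; cbn [fst snd].
      destruct (ridge_point_equation U xi1 xi2 x y HU H1 H2 HR)
        as (s & X & Hs & HX & HE).
      destruct (Hw _ _ _ _ HX) as (k & K1 & K2).
      fold D T in HE; unfold differential in HE; cbn [fst snd] in HE.
      assert (Gs : G s x y = 0).
      { unfold G; rewrite K1, K2, <- (Rmult_0_r k), <- HE; ring. }
      destruct Hs as [-> | ->]; rewrite Gs; ring. }
  unfold G in HG; rewrite Hd, sqrt_0, <- E1, <- E2 in HG.
  unfold differential; cbn [fst snd].
  (* At (u, v) the root vanishes and the fields agree, so [HG] says that minus the square of the
     wanted differential is 0. *)
  apply Rsqr_0_uniq; unfold Rsqr; lra.
Qed.

(** If b = c = 0, then D = 0 forces a = d, and dD vanishes because D is quadratic in (a - d, b, c),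
    against regularity. *)
Lemma regular_shape_not_scalar U xi1 xi2 u v :
  smooth_on U xi1 -> smooth_on U xi2 ->
  regular_value_0 U (discriminant xi1 xi2) -> U (u, v) ->
  discriminant xi1 xi2 u v = 0 ->
  S12 xi1 xi2 u v <> 0 \/ S21 xi1 xi2 u v <> 0.
Proof.
  intros H1 H2 Hreg Hp Hd.
  destruct (Req_dec (S12 xi1 xi2 u v) 0) as [Eb | ]; [| now left].
  destruct (Req_dec (S21 xi1 xi2 u v) 0) as [Ec | ]; [| now right].
  destruct (Hreg _ Hp Hd) as [X HX]; destruct HX.
  assert (Ea : S11 xi1 xi2 u v - S22 xi1 xi2 u v = 0).
  { apply Rsqr_0_uniq; unfold Rsqr.
    rewrite <- Hd; unfold discriminant; rewrite Eb; ring. }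
  unfold differential; cbn [fst snd].
  rewrite (d_u_discriminant U xi1 xi2 u v H1 H2 Hp).
  rewrite (d_v_discriminant U xi1 xi2 u v H1 H2 Hp).
  rewrite Ea, Eb, Ec; ring.
Qed.

Theorem mainTheorem7 (U : R * R -> Prop) (xi1 xi2 : R -> R -> R)
    (hU : open U) (hxi1 : smooth_on U xi1) (hxi2 : smooth_on U xi2)
    (hreg : regular_value_0 U (discriminant xi1 xi2))
    (p : R * R) (hp : U p)
    (hdp : discriminant xi1 xi2 (fst p) (snd p) = 0)
    (hridge : closure (ridge_point U xi1 xi2) p) :
  singular_point U xi1 xi2 p.
Proof.
  destruct p as [u v]; cbn [fst snd] in hdp.
  destruct (continuity_S U xi1 xi2 u v hU hxi1 hxi2 hp) as (CA & CB & CC & CD).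
  pose proof (continuity_sqrt_discriminant U xi1 xi2 u v hU hxi1 hxi2 hp) as Cr.
  set (a := S11 xi1 xi2) in *; set (b := S12 xi1 xi2) in *.
  set (c := S21 xi1 xi2) in *; set (d := S22 xi1 xi2) in *.
  set (r := fun x y => sqrt (discriminant xi1 xi2 x y)) in *.
  assert (r0 : r u v = 0) by (unfold r; rewrite hdp; apply sqrt_0).
  (* For l = (T + s r) / 2, twice the column (b, l - a) is (2 b, d - a + s r); [T2] uses twice (l -
     d, c) in the same way. *)
  assert (T1 : differential (discriminant xi1 xi2) (u, v)
                 (2 * b u v, d u v - a u v + 1 * r u v) = 0).
  { apply (closure_ridge_differential U xi1 xi2 u v (fun s x y => 2 * b x y)
             (fun s x y => d x y - a x y + s * r x y)); trivial.
    - intros s; split; continuity_2d.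
    - intros s x y X HX.
      destruct (eigenvector_shape _ _ _ _ _ _ HX) as (_ & (k & K1 & K2) & _).
      exists (2 * k); unfold trace in K2; unfold a, b, d, r; split; lra.
    - rewrite r0; ring. }
  assert (T2 : differential (discriminant xi1 xi2) (u, v)
                 (a u v - d u v + 1 * r u v, 2 * c u v) = 0).
  { apply (closure_ridge_differential U xi1 xi2 u v
             (fun s x y => a x y - d x y + s * r x y) (fun s x y => 2 * c x y)); trivial.
    - intros s; split; continuity_2d.
    - intros s x y X HX.
      destruct (eigenvector_shape _ _ _ _ _ _ HX) as (_ & _ & (k & K1 & K2)).
      exists (2 * k); unfold trace in K1; unfold a, c, d, r; split; lra.
    - rewrite r0; ring. }
  rewrite r0, Rmult_0_r, Rplus_0_r in T1, T2.
  assert (HD : (a u v - d u v) ^ 2 + 4 * b u v * c u v = 0) by exact hdp.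
  assert (Hdouble : forall m Y, eigenvector xi1 xi2 (u, v) m Y ->
    2 * m = a u v + d u v /\
    (exists k, b u v = k * fst Y /\ m - a u v = k * snd Y) /\
    (exists k, m - d u v = k * fst Y /\ c u v = k * snd Y)).
  { intros m Y HY; destruct (eigenvector_shape _ _ _ _ _ _ HY) as (Q & K).
    rewrite hdp in Q; split; [| exact K].
    apply Rminus_diag_uniq, Rsqr_0_uniq; unfold Rsqr.
    rewrite <- Q; unfold trace, a, d; ring. }
  (* The adjugate columns come as multiples of eigenvectors, whereas uniqueness asks for the
     converse; as X is non-zero, the factor can be inverted. *)
  assert (Hsuff : forall X, X <> (0, 0) ->
    shape xi1 xi2 (u, v) X = ((a u v + d u v) / 2 * fst X, (a u v + d u v) / 2 * snd X) ->
    (forall Y, principal_direction xi1 xi2 (u, v) Y ->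
       exists k, X = (k * fst Y, k * snd Y)) ->
    differential (discriminant xi1 xi2) (u, v) X = 0 ->
    singular_point U xi1 xi2 (u, v)).
  { intros X NX EX UX DX; split; [now split |].
    exists X; split; [| split].
    - exists ((a u v + d u v) / 2); now split.
    - intros Y HY; destruct (UX Y HY) as [k ->]; cbn [fst snd].
      assert (Nk : k <> 0) by (intros ->; apply NX; f_equal; ring).
      exists (/ k); destruct Y; cbn [fst snd]; f_equal; field; trivial.
    - apply (tangent_vector_zero_set U (discriminant xi1 xi2)); trivial.
      + intros [x y] Hq; now apply (C1_at_discriminant U).
      + now apply hreg. }
  destruct (regular_shape_not_scalar U xi1 xi2 u v hxi1 hxi2 hreg hp hdp) as [Nb | Nc].
  - apply (Hsuff (2 * b u v, d u v - a u v)); trivial.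
    + intros E; injection E as E _; apply Nb; fold b; lra.
    + unfold shape; fold a b c d; cbn [fst snd]; f_equal; [field |].
      (* The two sides differ by half the discriminant. *)
      apply Rminus_diag_uniq; rewrite <- (Rmult_0_r (/ 2)), <- HD; field.
    + intros Y [m HY]; destruct (Hdouble m Y HY) as (Em & (k & K1 & K2) & _).
      exists (2 * k); f_equal; lra.
  - apply (Hsuff (a u v - d u v, 2 * c u v)); trivial.
    + intros E; injection E as _ E; apply Nc; fold c; lra.
    + unfold shape; fold a b c d; cbn [fst snd]; f_equal; [| field].
      apply Rminus_diag_uniq; rewrite <- (Rmult_0_r (/ 2)), <- HD; field.
    + intros Y [m HY]; destruct (Hdouble m Y HY) as (Em & _ & (k & K1 & K2)).
      exists (2 * k); f_equal; lra.
Qed.
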